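(* Let $p$ be an odd prime and let $G$ be a group with $|G|=p^n$ and $|Z(G)|=p^{n-2}$. Then the number of edges of the commuting graph $\zeta(G,G)$ is $$\frac{p^{2n-1}+p^{2n-2}-p^{2n-3}-p^n}{2}.$$
   Context: $Z(G)$ is the center of $G$. The commuting graph $\zeta(G,G)$ is the simple graph with vertex set $G$ in which two distinct vertices are adjacent if and only if they commute in $G$. *)

(* Defs.v *)
From mathcomp Require Import all_boot all_order all_algebra all_fingroup all_solvable.

Set Implicit Arguments.
Unset Strict Implicit.
Unset Printing Implicit Defensive.

(* The edges of the simple graph on the vertex set V with symmetric irreflexive
   adjacency e, as unordered pairs: each edge is the two-element set of its
   endpoints, so it is counted once. *)
Definition edge_set (T : finType) (V : {set T}) (e : rel T) : {set {set T}} :=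
  [set [set x; y] | x in V, y in V & e x y].

Definition commuting_adj (gT : finGroupType) : rel gT :=
  fun x y => (x != y) && (x * y == y * x)%g.

Lemma commuting_adj_sym (gT : finGroupType) : symmetric (@commuting_adj gT).
Proof. by move=> x y; rewrite /commuting_adj eq_sym [(x * y)%g == _]eq_sym. Qed.

Lemma commuting_adj_irr (gT : finGroupType) : irreflexive (@commuting_adj gT).
Proof. by move=> x; rewrite /commuting_adj eqxx. Qed.

Definition commuting_graph_edges (gT : finGroupType) (G : {group gT}) :
    {set {set gT}} :=
  edge_set G (@commuting_adj gT).

(* Main.v *)
Require Import Defs.
From mathcomp Require Import all_boot all_order all_algebra all_fingroup all_solvable.
From mathcomp Require Import ring.

Import GRing.Theory.

(** Handshake: twice the number of edges is the number of ordered pairs of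
    distinct commuting elements, i.e. the sum of [#|'C_G[x]| - 1] over [G].
    A central [x] has centraliser [G]; for a noncentral [x] the centraliser lies
    strictly between ['Z(G)] and [G]; as ['Z(G)] has index [p ^ 2] in [G], its
    order must be [p ^ (n - 1)]. *)

Lemma handshake (T : finType) (V : {set T}) (e : rel T) :
    symmetric e -> irreflexive e ->
  (\sum_(x in V) #|[set y in V | e x y]| = #|edge_set V e| * 2)%N.
Proof.
move=> e_sym e_irr; pose S :=
  [set u : T * T | [&& u.1 \in V, u.2 \in V & e u.1 u.2]].
pose f (u : T * T) := [set u.1; u.2].
have edgeE : edge_set V e = f @: S.
  apply/setP=> E; apply/imset2P/imsetP.
    case=> x y Vx; rewrite !inE => /andP[Vy exy] ->.
    by exists (x, y); rewrite // inE /= Vx Vy.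
  case=> -[x y]; rewrite inE /= => /and3P[Vx Vy exy] ->.
  by exists x y; rewrite // inE Vy.
have -> : \sum_(x in V) #|[set y in V | e x y]| = \sum_(u in S) 1%N.
  under eq_bigr do rewrite -sum1_card.
  rewrite pair_big_dep /=; apply: eq_bigl => -[x y].
  by rewrite !inE.
(* Adjacent ordered pairs are grouped by their underlying edge; it remains to see that each fibre of
   [f] has exactly two elements. *)
rewrite (partition_big_imset f) /= -edgeE -sum_nat_const.
apply: eq_bigr => E; rewrite edgeE => /imsetP[[x y]].
rewrite inE /= => /and3P[Vx Vy exy] ->.
have neq_xy : x != y by apply: contraTneq exy => ->; rewrite e_irr.
have -> : 2 = #|[set (x, y); (y, x)]|.
  by rewrite cards2 xpair_eqE (negPf neq_xy).
rewrite sum1dep_card; apply: eq_card => -[a b].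
rewrite !inE !xpair_eqE /f /=; apply/andP/orP.
  (* Irreflexivity gives [a != b], which excludes the cases where both equal the same endpoint;
     symmetry is needed only for the converse, to admit the swapped pair. *)
  case=> /and3P[_ _ eab] /eqP eqf.
  have neq_ab : a != b by apply: contraTneq eab => ->; rewrite e_irr.
  have : a \in [set x; y] by rewrite -eqf set21.
  have : b \in [set x; y] by rewrite -eqf set22.
  rewrite !inE => /orP[]/eqP eb /orP[]/eqP ea; move: neq_ab;
    rewrite ea eb ?eqxx // => _; by [left | right].
case=> /andP[/eqP-> /eqP->]; first by rewrite Vx Vy exy.
by rewrite Vx Vy e_sym exy setUC.
Qed.

(** The successor accounts for [x] itself, which lies in its own centraliser but is not its own
    neighbour. *)
Lemma commuting_degree (gT : finGroupType) (G : {group gT}) (x : gT) :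
  x \in G -> (#|[set y in G | commuting_adj x y]|.+1 = #|'C_G[x]%g|)%N.
Proof.
move=> Gx; rewrite (cardsD1 x 'C_G[x]%g) in_setI Gx cent1id add1n.
congr _.+1; apply: eq_card => y.
rewrite inE in_setD1 in_setI cent1E /commuting_adj.
by rewrite eq_sym [(y * x)%g == _]eq_sym andbCA.
Qed.

Lemma card_cent1_noncentral (gT : finGroupType) (G : {group gT}) (p m : nat)
    (x : gT) :
    prime p -> #|G| = (p ^ m.+2)%N -> #|'Z(G)%g| = (p ^ m)%N ->
    x \in G -> x \notin 'Z(G)%g ->
  #|'C_G[x]%g| = (p ^ m.+1)%N.
Proof.
move=> p_pr oG oZ Gx nZx.
have p_gt1 := prime_gt1 p_pr.
have ltCG : ('C_G[x] \proper G)%g.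
  rewrite properE subsetIl subsetI subxx /=.
  by apply: contra nZx; rewrite sub_cent1 inE Gx.
have ltZC : ('Z(G) \proper 'C_G[x])%g.
  apply/properP; split; last by exists x; rewrite // in_setI Gx cent1id.
  by rewrite setIS // -cent_set1 centS // sub1set.
have /(dvdn_pfactor _ _ p_pr)[k _ oC] : (#|'C_G[x]%g| %| p ^ m.+2)%N.
  by rewrite -oG cardSg ?subsetIl.
(* Comparing exponents, the two strict inclusions become [m < k < m.+2]. *)
move: (proper_card ltCG) (proper_card ltZC); rewrite oG oZ oC !ltn_exp2l //.
by rewrite ltnS => le_km lt_mk; congr (_ ^ _)%N;
  apply/eqP; rewrite eqn_leq le_km.
Qed.

(** The sum splits over ['Z(G)] and its complement in [G], and the summand is constant on each
    part. *)
Lemma card_commuting_pairs (gT : finGroupType) (G : {group gT}) (p m : nat) :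
    prime p -> #|G| = (p ^ m.+2)%N -> #|'Z(G)%g| = (p ^ m)%N ->
  (\sum_(x in G) #|'C_G[x]%g| =
     p ^ m * p ^ m.+2 + (p ^ m.+2 - p ^ m) * p ^ m.+1)%N.
Proof.
move=> p_pr oG oZ; rewrite (big_setID 'Z(G)%g) /=; congr (_ + _)%N.
  rewrite (setIidPr (center_sub G)) -oZ -sum_nat_const.
  apply: eq_bigr => x /setIP[_]; rewrite -sub_cent1 => /setIidPl->.
  exact: oG.
rewrite -oG -{1}oZ -(cardsDS (center_sub G)) -sum_nat_const.
apply: eq_bigr => x /setDP[Gx nZx].
exact: card_cent1_noncentral nZx.
Qed.

Local Open Scope ring_scope.

Theorem corollary3p3 (gT : finGroupType) (G : {group gT}) (p n : nat)
    (hp : prime p) (hodd : odd p) (hn : (2 <= n)%N)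
    (hG : #|G| = (p ^ n)%N)
    (hZ : #|'Z(G)%g| = (p ^ (n - 2))%N) :
  #|commuting_graph_edges G|%:R =
    (p%:R ^+ (2 * n - 1) + p%:R ^+ (2 * n - 2) - p%:R ^+ (2 * n - 3)
       - p%:R ^+ n) / 2%:R :> rat.
Proof.
case: n hn hG hZ => [|[|m]] // _ oG; rewrite subSS subSS subn0 => oZ.
(* Adding [#|G|], one for each vertex, turns the sum of degrees into the sum of centraliser
   orders. *)
have count : (#|commuting_graph_edges G| * 2 + p ^ m.+2 =
    p ^ m * p ^ m.+2 + (p ^ m.+2 - p ^ m) * p ^ m.+1)%N.
  rewrite -(card_commuting_pairs _ _ _ _ hp oG oZ) -oG.
  rewrite -(handshake _ _ _ (@commuting_adj_sym gT) (@commuting_adj_irr gT)).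
  rewrite -sum1_card -big_split /=; apply: eq_bigr => x Gx.
  by rewrite addn1 commuting_degree.
(* This bound lets the truncated subtraction in [count] be cast to a rational one. *)
have le_pm : (p ^ m <= p ^ m.+2)%N by rewrite leq_exp2l ?prime_gt1 // ltnW.
(* Subtraction-free exponents let every power be expanded into [p%:R ^+ m] and [p%:R], as [ring]
   requires. *)
have -> : (2 * m.+2 - 1 = m + m + 3)%N
  by rewrite mul2n -addnn !addnS !addSn subn1 addn0.
have -> : (2 * m.+2 - 2 = m + m + 2)%N
  by rewrite mul2n -addnn !addnS !addSn subn2 addn0.
have -> : (2 * m.+2 - 3 = m + m + 1)%N
  by rewrite mul2n -addnn !addnS !addSn !subSS subn0 addn0.
move/(congr1 (fun k => k%:R : rat)): count.
rewrite !natrD !natrM natrB // !natrX !exprD !exprS => count.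
apply: (@mulIf _ 2%:R) => //; rewrite divfK //; apply: (addIr (p%:R ^+ m.+2)).
rewrite !exprS count; ring.
Qed.
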